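(* Let $k\in\mathbb N$, let $w\in F_{k+1}$ be a reduced word, let $\mathbf f\colon\mathbb N\to\mathbb N_+$ be some function and let $G\le\mathrm{Aut}(\mathcal T)$ be an $\mathbf f$-Engel-$w$ group of automorphisms of some rooted tree $\mathcal T$ that is generated by a finite set $S$. Assume that $G$ is contracting (with respect to the generating set $S$) with respect to a function $\mathbf g\colon\mathbb N\to\mathbb N_+$ such that $$\max\{a(w)^{\mathbf f},\mathbf f\}\prec\mathbf g$$ and a constant $c\in\mathbb R_+$. Suppose there exists some $n\in\mathbb N$ such that for all $m\ge n$, every collection of elements $h_1,\dots,h_k\in G$ with $\mathrm{dpt}(h_j)\le m$ for all $j\in\{1,\dots,k\}$, every orbit $\mathcal O$ of $\mathcal L(m)$ under $T=\langle h_1|^{\mathcal L(m)},\dots,h_k|^{\mathcal L(m)}\rangle$, and every element $g\in\mathrm{St}_G(m)$ with $\mathrm{dpt}(g)\le m$, the expression $$w_{\circ i}\big((g|_x)_{x\in\mathcal O},\ (h_1|_x)_{x\in\mathcal O}\,h_1|^{\mathcal L(m)},\ \dots,\ (h_k|_x)_{x\in\mathcal O}\,h_k|^{\mathcal L(m)}\big)\in \mathrm U_m(G)\wr_{\mathcal O}T$$ is trivial for some $i\in\mathbb N$. Then $G$ is an Engel-$w$ group.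
   Context: $\mathbb N=\{0,1,2,\dots\}$, and $\mathbb N_+$, $\mathbb R_+$ denote positive integers and positive reals. For functions $\mathbf f,\mathbf g\colon\mathbb N\to\mathbb R_+$, $\mathbf f\prec\mathbf g$ means $\lim_{n\to\infty}\mathbf f(n)/\mathbf g(n)=0$. Iterated identities: $F_{k+1}$ is the free group on $x,y_1,\dots,y_k$; a word $w\in F_{k+1}$ induces a word map $w\colon G^{k+1}\to G$ on any group. Put $w_{\circ 0}(x,y_1,\dots,y_k)=x$ and $w_{\circ n+1}(x,y_1,\dots,y_k)=w(w_{\circ n}(x,y_1,\dots,y_k),y_1,\dots,y_k)$. A group $G$ is an Engel-$w$ group if for all $x,y_1,\dots,y_k\in G$ there is $n\in\mathbb N$ with $w_{\circ n}(x,y_1,\dots,y_k)=\mathrm{id}$; it is an $n$-Engel-$w$ group if $w_{\circ n}$ is a law in $G$. $a(w)$ is the number of occurrences of $x$ or $x^{-1}$ in the reduced word $w$; $a(w)^{\mathbf f}$ is the function $n\mapsto a(w)^{\mathbf f(n)}$. Trees: for a sequence $\mathcal X=(X_n)_{n\in\mathbb N}$ of finite sets of cardinality at least $2$, the rooted tree $\mathcal T=\mathcal T_{\mathcal X}$ has as vertices all finite strings with $i$-th letter in $X_i$ (counting from $0$), including the empty string (root), with edges between a string and its one-letter extensions. $\mathcal L(n)$ is the set of strings of length $n$. $\mathrm{Aut}(\mathcal T)$ is the group of root-preserving automorphisms, acting on the right; for $u\in\mathcal L(n)$ the section $g|_u\in\mathrm{Aut}(\mathcal T_{(X_m)_{m\ge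 n}})$ is defined by $(uv).g=(u.g)(v.(g|_u))$. $g|^{\mathcal L(n)}$ is the action of $g$ on the finite tree of strings of length at most $n$ (equivalently, on $\mathcal L(n)$). $\mathrm{St}_G(n)$ is the pointwise stabiliser of $\mathcal L(n)$ in $G$. $\mathrm U_n(G)$ is the group generated by all $g|_u$, $g\in G$, $u\in\mathcal L(n)$. If $G=\langle S\rangle$, then $S|_n=\bigcup_{u\in\mathcal L(n)}\{s|_u: s\in S\}$ generates $\mathrm U_n(G)$; $\ell_{S|_n}$ is word length with respect to $S|_n$ (so $\ell_{S|_0}=\ell_S$). $G\le\mathrm{Aut}(\mathcal T)$ is called $\mathbf f$-Engel-$w$ if $G/\mathrm{St}_G(n)$ is an $\mathbf f(n)$-Engel-$w$ group for every $n$. Contracting: for a strictly increasing function $\mathbf g\colon\mathbb N\to\mathbb R_{>1}$ and $c\in\mathbb R_+$, the group $G=\langle S\rangle$ is contracting with respect to $\mathbf g$ and $c$ if there is $n\in\mathbb N$ such that for all $m\ge n$, all $g\in G$ and all $u\in\mathcal L(m)$ we have $\ell_{S|_m}(g|_u)\le \ell_{S}(g)/\mathbf g(m)+c$. (So in the claim $\mathbf g$ is understood to be strictly increasing with values greater than $1$.) The depth $\mathrm{dpt}(g)\in\mathbb N\cup\{\infty\}$ of $g\in G$ is the least $d$ such that $\ell_{S|_d}(g|_u)\le c$ for all $u\in\mathcal L(d)$ (and $\infty$ if there is none). Wreath products: for $T$ acting on the right on a finite set $\mathcal O$, $H\wr_{\mathcal O}T=H^{\mathcal O}\rtimes T$ with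 $t\,(g_x)_{x\in\mathcal O}=(g_{x.t})_{x\in\mathcal O}\,t$. *)

(* Defs.v *)
From HB Require Import structures.
From mathcomp Require Import all_boot all_order all_algebra all_fingroup generic_quotient.
From mathcomp Require Import all_classical all_reals all_analysis.

Set Implicit Arguments.
Unset Strict Implicit.
Unset Printing Implicit Defensive.

Import Order.TTheory GRing.Theory Num.Theory.
Import numFieldNormedType.Exports.

(* The least element of [P], with [None] (infinity) if [P] is empty. *)
Definition least (P : nat -> Prop) : option nat :=
  if pselect (exists n, `[< P n >]) is left e then Some (ex_minn e) else None.

Definition at_most (d : option nat) (m : nat) : bool :=
  if d is Some d' then (d' <= m)%N else false.

Section Groups.
Local Open Scope group_scope.
Local Open Scope quotient_scope.

(* A subgroup of [gT] is a [groupClosed gT]; [subT G] is G as a group in its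
   own right. *)
Definition subT (gT : groupType) (G : groupClosed gT) := {x : gT | x \in G}.

Section SubGroup.
Variables (gT : groupType) (G : groupClosed gT).

HB.instance Definition _ := SubChoice.on (subT G).

Fact subT_closed : group_closed (fun x => x \in G).
Proof.
by split=> [|x y Gx Gy]; [exact: gpred1 | exact: gpredM Gx (gpredVr _ Gy)].
Qed.

HB.instance Definition _ :=
  SubChoice_isSubGroup.Build gT (fun x => x \in G) (subT G) subT_closed.
End SubGroup.

Section Generation.
Variables (gT : groupType) (S : set gT).

Definition generated_by : {pred gT} :=
  fun x => `[< smallest (fun A : set gT => group_closed (mem A)) S x >].

Fact generated_closed : group_closed generated_by.
Proof.
split=> [|x y /asboolP Sx /asboolP Sy]; apply/asboolP => A /= [[A1 AV] SA].
  by have := A1; rewrite inE.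
by apply/set_mem/AV; apply/mem_set; [apply: Sx | apply: Sy].
Qed.

Fact gen1 : 1 \in generated_by. Proof. by case: generated_closed. Qed.
Fact genV : invg_closed generated_by.
Proof.
by move=> x Sx; rewrite -[x^-1]mul1g; apply: generated_closed.2 => //; apply: gen1.
Qed.
Fact genM : mulg_closed generated_by.
Proof.
by move=> x y Sx Sy; rewrite -[y]invgK; apply: generated_closed.2 => //; apply: genV.
Qed.

HB.instance Definition _ := isMulClosed.Build gT generated_by genM.
HB.instance Definition _ := isMul1Closed.Build gT generated_by gen1.
HB.instance Definition _ := isInvClosed.Build gT generated_by genV.

Lemma mem_generated x : S x -> x \in generated_by.
Proof. by move=> Sx; apply/asboolP => A [_]; apply. Qed.

(* The default value 0 is only taken outside the subgroup generated by [S]. *)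
Definition wlen (g : gT) : nat :=
  odflt 0%N (least (fun n => exists s : seq gT,
    [/\ size s = n, forall a, a \in s -> S a \/ S a^-1
      & \prod_(a <- s) a = g])).
End Generation.

Record normalClosed (gT : groupType) := NormalClosed {
  normal_pred :> groupClosed gT;
  normalJ : forall x y : gT, x \in normal_pred -> x ^ y \in normal_pred
}.

Section Quotient.
Variables (gT : groupType) (N : normalClosed gT).

Definition coset_rel (x y : gT) : bool := x^-1 * y \in N.

Fact coset_rel_equiv : equiv_class_of coset_rel.
Proof.
split=> [x|x y|y x z].
- by rewrite /coset_rel mulVg gpred1.
- by apply/idP/idP => /(gpredVr _); rewrite invgM invgK.
- by move=> xy yz; have := gpredM _ _ xy yz; rewrite mulgA mulgK.
Qed.

Canonical coset_equiv := EquivRelPack coset_rel_equiv.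

Definition quoT : Type := {eq_quot coset_equiv}.
HB.instance Definition _ := Choice.on quoT.
HB.instance Definition _ := EqQuotient.on quoT.

Definition coset_proj (x : gT) : quoT := \pi_quoT x.

Lemma coset_projP x y : reflect (coset_proj x = coset_proj y) (x^-1 * y \in N).
Proof. exact: (@eqquotP _ _ quoT). Qed.

Definition quo_one : quoT := coset_proj 1.
Definition quo_mul (a b : quoT) : quoT := coset_proj (repr a * repr b).
Definition quo_inv (a : quoT) : quoT := coset_proj (repr a)^-1.

Fact coset_projK a : coset_proj (repr a) = a. Proof. exact: reprK. Qed.

Fact coset_repr x : (repr (coset_proj x))^-1 * x \in N.
Proof. by apply/coset_projP; rewrite coset_projK. Qed.

Lemma coset_projM x y : coset_proj (x * y) = quo_mul (coset_proj x) (coset_proj y).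
Proof.
apply/esym/coset_projP; rewrite invgM.
set x' := repr (coset_proj x); set y' := repr (coset_proj y).
have -> : y'^-1 * x'^-1 * (x * y) = (y'^-1 * y) * ((x'^-1 * x) ^ y).
  by rewrite conjgE !mulgA mulgK.
by apply: gpredM; [exact: coset_repr | apply: normalJ; exact: coset_repr].
Qed.

Lemma coset_projV x : coset_proj x^-1 = quo_inv (coset_proj x).
Proof.
apply/coset_projP; rewrite invgK; set x' := repr _.
have -> : x * x'^-1 = ((x'^-1 * x) ^ x'^-1).
  by rewrite conjgE invgK !mulgA mulgV mul1g.
by apply: normalJ; exact: coset_repr.
Qed.

Fact quo_mulA : associative quo_mul.
Proof.
by move=> a b c; rewrite -[a]coset_projK -[b]coset_projK -[c]coset_projK
  -!coset_projM mulgA.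
Qed.
Fact quo_mul1 : left_id quo_one quo_mul.
Proof. by move=> a; rewrite -[a]coset_projK -coset_projM mul1g. Qed.
Fact quo_mul1r : right_id quo_one quo_mul.
Proof. by move=> a; rewrite -[a]coset_projK -coset_projM mulg1. Qed.
Fact quo_mulV : left_inverse quo_one quo_inv quo_mul.
Proof. by move=> a; rewrite -[a]coset_projK -coset_projV -coset_projM mulVg. Qed.
Fact quo_mulVr : right_inverse quo_one quo_inv quo_mul.
Proof. by move=> a; rewrite -[a]coset_projK -coset_projV -coset_projM mulgV. Qed.

HB.instance Definition _ :=
  isGroup.Build quoT quo_mulA quo_mul1 quo_mul1r quo_mulV quo_mulVr.
End Quotient.

(* Letters of the free group on x, y_1, ..., y_k: [None] is x, [Some j] is
   y_(j+1), and the boolean is [true] for the inverse of the generator. *)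
Definition letter (k : nat) : Type := (option 'I_k * bool)%type.
Definition word (k : nat) : Type := seq (letter k).

Definition reduced k (w : word k) : bool :=
  sorted (fun a b : letter k => ~~ ((a.1 == b.1) && (a.2 != b.2))) w.

Definition occ_x k (w : word k) : nat :=
  count (fun a : letter k => a.1 == None) w.

Section WordMaps.
Variables (k : nat) (w : word k) (gT : groupType).

Definition letter_val (x : gT) (y : 'I_k -> gT) (a : letter k) : gT :=
  let z := if a.1 is Some j then y j else x in if a.2 then z^-1 else z.

Definition word_map (x : gT) (y : 'I_k -> gT) : gT :=
  \prod_(a <- w) letter_val x y a.

Definition word_iter (n : nat) (x : gT) (y : 'I_k -> gT) : gT :=
  iter n (fun z => word_map z y) x.

Definition Engel : Prop :=
  forall (x : gT) (y : 'I_k -> gT), exists n, word_iter n x y = 1.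

Definition nEngel (n : nat) : Prop :=
  forall (x : gT) (y : 'I_k -> gT), word_iter n x y = 1.
End WordMaps.

(* The pair [(a, t)] stands for the product (a_x)_x t; the multiplication below
   is the one with t (b_x)_x = (b_(x.t))_x t. *)
Definition wreath (H : groupType) (T : finGroupType) (O : finType)
  (to : {action T &-> O}) : Type := ({ffun O -> H} * T)%type.
HB.instance Definition _ (H : groupType) (T : finGroupType) (O : finType)
  (to : {action T &-> O}) := Choice.on (wreath H to).

Section Wreath.
Variables (H : groupType) (T : finGroupType) (O : finType).
Variable to : {action T &-> O}.
Local Notation wreath := (wreath H).

Definition wr_one : wreath to := ([ffun => 1], 1).
Definition wr_mul (a b : wreath to) : wreath to :=
  ([ffun x => a.1 x * b.1 (to x a.2)], a.2 * b.2).
Definition wr_inv (a : wreath to) : wreath to :=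
  ([ffun x => (a.1 (to x a.2^-1))^-1], a.2^-1).

Fact wr_mulA : associative wr_mul.
Proof.
move=> [a s] [b t] [c r]; congr pair; rewrite /= ?mulgA //.
by apply/ffunP => x; rewrite !ffunE /= mulgA actM.
Qed.
Fact wr_mul1 : left_id wr_one wr_mul.
Proof.
move=> [a s]; congr pair; rewrite /= ?mul1g //.
by apply/ffunP => x; rewrite !ffunE /= act1 mul1g.
Qed.
Fact wr_mul1r : right_id wr_one wr_mul.
Proof.
move=> [a s]; congr pair; rewrite /= ?mulg1 //.
by apply/ffunP => x; rewrite !ffunE /= mulg1.
Qed.
Fact wr_mulV : left_inverse wr_one wr_inv wr_mul.
Proof.
move=> [a s]; congr pair; rewrite /= ?mulVg //.
by apply/ffunP => x; rewrite !ffunE /= mulVg.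
Qed.
Fact wr_mulVr : right_inverse wr_one wr_inv wr_mul.
Proof.
move=> [a s]; congr pair; rewrite /= ?mulgV //.
by apply/ffunP => x; rewrite !ffunE /= actK mulgV.
Qed.

HB.instance Definition _ :=
  isGroup.Build (wreath to) wr_mulA wr_mul1 wr_mul1r wr_mulV wr_mulVr.
End Wreath.

Section OrbitAction.
Variables (L : finType) (T : {group {perm L}}) (p : L).

Definition orbT : Type := {x : L | x \in orbit 'P T p}.
HB.instance Definition _ := Finite.on orbT.
HB.instance Definition _ := SubChoice.on orbT.

Fact orbT_stable (x : orbT) (t : subg_of T) :
  val t (val x) \in orbit 'P T p.
Proof.
have Tt : val t \in T by exact: subgP.
by have := valP x; rewrite -(orbit_actr 'P%act _ _ Tt).
Qed.

Definition orb_act (x : orbT) (t : subg_of T) : orbT :=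
  exist (fun z => z \in orbit 'P T p) _ (orbT_stable x t).

Fact orb_act_is_action : is_action [set: subg_of T] orb_act.
Proof.
split=> [t x y /(congr1 val) /= /perm_inj/val_inj //|x s t _ _].
by apply: val_inj; rewrite /= permM.
Qed.

Definition orb_action : {action subg_of T &-> orbT} := Action orb_act_is_action.
End OrbitAction.

End Groups.

Definition shift_seq (n : nat) (X : nat -> finType) : nat -> finType :=
  fun i => X (n + i)%N.

(* Strings of length n, as nested pairs ending in [tt]. *)
Fixpoint level (X : nat -> finType) (n : nat) : finType :=
  if n is n'.+1 then (X 0%N * level (fun i => X i.+1) n')%type else unit.

Definition vertex (X : nat -> finType) : Type := {n : nat & level X n}.

Definition root_vertex (X : nat -> finType) : vertex X := Tagged (level X) (i := 0%N) tt.

Definition vcons (X : nat -> finType) (a : X 0%N) (v : vertex (fun i => X i.+1)) : vertex X :=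
  Tagged (level X) (i := (tag v).+1) (a, tagged v).

Fixpoint lrcons (X : nat -> finType) n : level X n -> X n -> level X n.+1 :=
  match n with
  | 0 => fun _ a => (a, tt)
  | n'.+1 => fun u a => (u.1, @lrcons (fun i => X i.+1) n' u.2 a)
  end.

Definition child (X : nat -> finType) (u v : vertex X) : Prop :=
  exists a : X (tag u), v = Tagged (level X) (lrcons (tagged u) a).

Definition adj (X : nat -> finType) (u v : vertex X) : Prop := child u v \/ child v u.

(* Concatenation of a string u in L(n) with a vertex of the shifted tree. *)
Fixpoint vcat (X : nat -> finType) n : level X n -> vertex (shift_seq n X) -> vertex X :=
  match n with
  | 0 => fun _ v => v
  | n'.+1 => fun u v => vcons u.1 (@vcat (fun i => X i.+1) n' u.2 v)
  end.

(* Removal of the first n letters; junk (the root) if there are fewer. *)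
Fixpoint vdrop (X : nat -> finType) n : vertex X -> vertex (shift_seq n X) :=
  match n with
  | 0 => fun v => v
  | n'.+1 => fun v =>
      match v with
      | existT m'.+1 u => @vdrop (fun i => X i.+1) n' (Tagged (level (fun i => X i.+1)) u.2)
      | _ => root_vertex (shift_seq n'.+1 X)
      end
  end.

Lemma vcatK (X : nat -> finType) n (u : level X n) : cancel (vcat u) (@vdrop X n).
Proof.
elim: n X u => [|n IH] X u v //=.
by have := IH (fun i => X i.+1) u.2 v; case: (vcat _ _).
Qed.

Lemma vcat_root (X : nat -> finType) n (u : level X n) :
  vcat u (root_vertex _) = Tagged (level X) u.
Proof.
by elim: n X u => [|n IH] X /= [] // a u; rewrite IH.
Qed.

Lemma child_tag (X : nat -> finType) (u v : vertex X) : child u v -> tag v = (tag u).+1.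
Proof. by case=> a ->. Qed.

Fact lrcons_surj (X : nat -> finType) n (u : level X n.+1) : exists v a, u = lrcons v a.
Proof.
elim: n X u => [|n IH] X [a u]; first by case: u; exists tt, a.
by have [v [b ->]] := IH (fun i => X i.+1) u; exists (a, v), b.
Qed.

Lemma child_ex (X : nat -> finType) (v : vertex X) : (0 < tag v)%N -> exists u, child u v.
Proof.
case: v => [[|n] v] // _; have [u [a ->]] := lrcons_surj v.
by exists (Tagged (level X) u), a.
Qed.

Fixpoint lbelast (X : nat -> finType) n : level X n.+1 -> level X n :=
  match n with
  | 0 => fun _ => tt
  | n'.+1 => fun u => (u.1, @lbelast (fun i => X i.+1) n' u.2)
  end.

Fact lrconsK (X : nat -> finType) n (u : level X n) a : lbelast (lrcons u a) = u.
Proof.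
by elim: n X u a => [|n IH] X; case=> // b u a /=; rewrite IH.
Qed.

Definition vparent (X : nat -> finType) (v : vertex X) : vertex X :=
  match v with
  | existT n'.+1 u => Tagged (level X) (lbelast u)
  | _ => v
  end.

Fact child_parent (X : nat -> finType) (u v : vertex X) : child u v -> vparent v = u.
Proof. by case=> a ->; rewrite /= lrconsK; case: u a. Qed.

Lemma child_uniq (X : nat -> finType) (u u' v : vertex X) : child u v -> child u' v -> u = u'.
Proof. by move=> /child_parent <- /child_parent <-. Qed.

Fact child_vcons (X : nat -> finType) (a : X 0%N) u v : child u v -> child (vcons a u) (vcons a v).
Proof. by case=> b ->; exists b. Qed.

Fact child_vconsI (X : nat -> finType) (a : X 0%N) u v : child (vcons a u) v ->
  exists2 v', v = vcons a v' & child u v'.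
Proof.
case=> b ->; exists (Tagged (level (fun i => X i.+1)) (lrcons (tagged u) b)) => //.
by exists b.
Qed.

Lemma child_vcat (X : nat -> finType) n (u : level X n) v v' :
  child v v' -> child (vcat u v) (vcat u v').
Proof.
by elim: n X u v v' => [|n IH] X u v v' //= /(IH (fun i => X i.+1) u.2)/child_vcons; apply.
Qed.

Lemma child_vcatI (X : nat -> finType) n (u : level X n) v v' :
  child (vcat u v) v' -> exists2 q, v' = vcat u q & child v q.
Proof.
elim: n X u v v' => [|n IH] X u v v' /=; first by exists v'.
by case/child_vconsI => z -> /IH [q -> qP]; exists q.
Qed.

Lemma child_vcatE (X : nat -> finType) n (u : level X n) v v' :
  child (vcat u v) (vcat u v') <-> child v v'.
Proof.
split; last exact: child_vcat.
by case/child_vcatI => q /(can_inj (vcatK u)) ->.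
Qed.

(* Root-preserving graph automorphisms; [aut_inv] is the inverse bijection. *)
Record tree_aut (X : nat -> finType) := TreeAut {
  aut_fun :> vertex X -> vertex X;
  aut_inv : vertex X -> vertex X;
  autK : cancel aut_fun aut_inv;
  autKV : cancel aut_inv aut_fun;
  aut_root : aut_fun (root_vertex X) = root_vertex X;
  aut_adj : forall u v, adj (aut_fun u) (aut_fun v) <-> adj u v
}.

Lemma aut_ext (X : nat -> finType) (g h : tree_aut X) : g =1 h -> g = h.
Proof.
case: g h => [f f' fK fKV f1 fe] [h h' hK hKV h1 he] /= /funext fh.
rewrite -{}fh in hK hKV h1 he *.
have hf : f' = h' by apply/funext => v; rewrite -[v in LHS]hKV fK.
rewrite -{}hf in hK hKV *.
by congr TreeAut; exact: Prop_irrelevance.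
Qed.

HB.instance Definition _ X := gen_eqMixin (tree_aut X).
HB.instance Definition _ X := gen_choiceMixin (tree_aut X).

Section AutGroup.
Variable X : nat -> finType.
Implicit Types g h : tree_aut X.

Definition aut_one : tree_aut X.
Proof. by apply: (@TreeAut X id id). Defined.

(* Automorphisms act on the right: v.(gh) = (v.g).h *)
Definition aut_mul g h : tree_aut X.
Proof.
apply: (@TreeAut X (h \o g) (aut_inv g \o aut_inv h)).
- exact: can_comp (@autK _ h) (@autK _ g).
- exact: can_comp (@autKV _ g) (@autKV _ h).
- by rewrite /= !aut_root.
- by move=> u v; rewrite /= !aut_adj.
Defined.

Definition aut_opp g : tree_aut X.
Proof.
apply: (@TreeAut X (aut_inv g) g (@autKV _ g) (@autK _ g)).
- by rewrite -[RHS](autK g) aut_root.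
- by move=> u v; rewrite -(aut_adj g) !autKV.
Defined.

Fact aut_mulA : associative aut_mul. Proof. by move=> *; apply: aut_ext. Qed.
Fact aut_mul1 : left_id aut_one aut_mul. Proof. by move=> *; apply: aut_ext. Qed.
Fact aut_mul1r : right_id aut_one aut_mul. Proof. by move=> *; apply: aut_ext. Qed.
Fact aut_mulV : left_inverse aut_one aut_opp aut_mul.
Proof. by move=> g; apply: aut_ext => v /=; rewrite autKV. Qed.
Fact aut_mulVr : right_inverse aut_one aut_opp aut_mul.
Proof. by move=> g; apply: aut_ext => v /=; rewrite autK. Qed.

HB.instance Definition _ :=
  isGroup.Build (tree_aut X) aut_mulA aut_mul1 aut_mul1r aut_mulV aut_mulVr.

Lemma aut_tag g v : tag (g v) = tag v.
Proof.
move: {2}(tag v) (erefl (tag v)) => n; elim/ltn_ind: n v => n IH v vn.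
case: n => [|n] in IH vn *.
  by case: v vn => [[|//] []] _; rewrite aut_root.
have [|u uv] := @child_ex _ v; first by rewrite vn.
have un : tag u = n by apply: succn_inj; rewrite -vn (child_tag uv).
have gun := IH n (ltnSn n) u un.
have /(aut_adj g)[/child_tag ->|gvu] : adj u v by left.
  by rewrite gun un vn.
case: n => [|n] in IH vn un gun *.
  by have := child_tag gvu; rewrite gun un.
have [|q qu] := @child_ex _ u; first by rewrite un.
have qn : tag q = n by apply: succn_inj; rewrite -un (child_tag qu).
have gqn := IH n (ltnW (ltnSn _)) q qn.
have /(aut_adj g)[gqu|/child_tag] : adj q u by left.
  have /(can_inj (autK g)) qv := child_uniq gqu gvu.
  by move: vn; rewrite -qv qn => /esym/eqP; rewrite eqn_leq ltnNge leqnSn.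
by rewrite gqn gun un qn => /eqP; rewrite eqn_leq [_.+2 <= _]leqNgt ltnS leqnSn andbF.
Qed.

Lemma aut_child g u v : child (g u) (g v) <-> child u v.
Proof.
have asym (a b : vertex X) : tag b = (tag a).+1 -> ~ child b a.
  move=> ab /child_tag; rewrite ab => /eqP.
  by rewrite ltn_eqF // ltnS leqnSn.
split=> uv.
  have /(aut_adj g)[//|vu] : adj (g u) (g v) by left.
  by case: (asym u v) => //; rewrite -(aut_tag g u) -(aut_tag g v) (child_tag uv).
have /(aut_adj g)[//|vu] : adj u v by left.
by case: (asym (g u) (g v)) => //; rewrite !aut_tag (child_tag uv).
Qed.

(* The action of [g] on L(n); the cast is harmless by [lactE]. *)
Definition lact n g (u : level X n) : level X n :=
  tagged_as (Tagged (level X) u) (g (Tagged (level X) u)).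

Lemma lactE n g (u : level X n) :
  Tagged (level X) (lact g u) = g (Tagged (level X) u).
Proof.
have := aut_tag g (Tagged (level X) u); rewrite /lact.
case: (g _) => m v /= mn; case: _ / mn u => u.
by rewrite /tagged_as; case: eqP => // e; rewrite (eq_axiomK e).
Qed.

Fact Tagged_level_inj n : injective (fun u : level X n => Tagged (level X) u).
Proof. by move=> u v /eqP; rewrite eq_Tagged => /eqP. Qed.

Fact lact_inj n g : injective (@lact n g).
Proof.
by move=> u v uv; apply/Tagged_level_inj/(can_inj (autK g)); rewrite -!lactE uv.
Qed.

Definition lperm g n : {perm level X n} := perm (@lact_inj n g).

Fact aut_vcat g n (u : level X n) v :
  g (vcat u v) = vcat (lact g u) (vdrop n (g (vcat u v))).
Proof.
suff [q ->] : exists q, g (vcat u v) = vcat (lact g u) q by rewrite vcatK.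
move: {2}(tag v) (erefl (tag v)) => m; elim: m v => [|m IH] v vm.
  case: v vm => [[|//] []] _; exists (root_vertex _).
  by rewrite !vcat_root lactE.
have [|p pv] := @child_ex _ v; first by rewrite vm.
have [|q qP] := IH p; first by apply: succn_inj; rewrite -vm (child_tag pv).
have /(aut_child g) : child (vcat u p) (vcat u v) by apply: child_vcat.
by rewrite qP => /child_vcatI[q' -> _]; exists q'.
Qed.

Section SectionAut.
Variables (g : tree_aut X) (n : nat) (u : level X n).

Let sec (h : tree_aut X) (z : level X n) v := vdrop n (h (vcat z v)).

Fact sec_root : sec g u (root_vertex _) = root_vertex _.
Proof. by rewrite /sec vcat_root -lactE -vcat_root vcatK. Qed.

Fact sec_adj v v' : adj (sec g u v) (sec g u v') <-> adj v v'.
Proof.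
have sec_child a b : child (sec g u a) (sec g u b) <-> child a b.
  by rewrite -(child_vcatE (lact g u)) /sec -!aut_vcat aut_child child_vcatE.
by rewrite /adj !sec_child.
Qed.

Fact secK : cancel (sec g u) (sec (aut_opp g) (lact g u)).
Proof.
by move=> v; rewrite /sec -aut_vcat /= autK vcatK.
Qed.

Fact lactK : lact (aut_opp g) (lact g u) = u.
Proof.
by apply: Tagged_level_inj; rewrite /= !lactE /= autK.
Qed.

Fact secKV : cancel (sec (aut_opp g) (lact g u)) (sec g u).
Proof.
move=> v; rewrite /sec -[in X in vcat X]lactK -aut_vcat /= autKV vcatK //.
Qed.

Definition aut_section : tree_aut (shift_seq n X) := TreeAut secK secKV sec_root sec_adj.

Lemma sectionE v : g (vcat u v) = vcat (lact g u) (aut_section v).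
Proof. exact: aut_vcat. Qed.
End SectionAut.
End AutGroup.

Section Stabiliser.
Variables (X : nat -> finType) (G : groupClosed (tree_aut X)) (n : nat).
Local Open Scope group_scope.

Definition stab : {pred subT G} :=
  fun g => [forall u : level X n, lact (val g) u == u].

Fact lactM (g h : tree_aut X) (u : level X n) : lact (g * h) u = lact h (lact g u).
Proof. by apply: Tagged_level_inj; rewrite /= !lactE. Qed.

Fact lact1 (u : level X n) : lact 1 u = u.
Proof. by apply: Tagged_level_inj; rewrite /= !lactE. Qed.

Fact stab1 : 1 \in stab.
Proof. by apply/forallP => u; rewrite lact1. Qed.

Fact stabM : mulg_closed stab.
Proof.
move=> g h /forallP gS /forallP hS; apply/forallP => u.
by rewrite lactM (eqP (gS u)) hS.
Qed.

Fact stabV : invg_closed stab.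
Proof.
move=> g /forallP gS; apply/forallP => u.
by rewrite -[X in lact _ X](eqP (gS u)) -lactM -valM mulgV lact1.
Qed.

HB.instance Definition _ := isMulClosed.Build (subT G) stab stabM.
HB.instance Definition _ := isMul1Closed.Build (subT G) stab stab1.
HB.instance Definition _ := isInvClosed.Build (subT G) stab stabV.

Fact stabJ (g h : subT G) : g \in stab -> g ^ h \in stab.
Proof.
move=> /forallP gS; apply/forallP => u.
by rewrite conjgE 2!lactM (eqP (gS _)) -lactM -valM mulVg lact1.
Qed.

Definition stabN : normalClosed (subT G) := NormalClosed stabJ.
End Stabiliser.
Arguments stab {X} G n _.

Definition sections (X : nat -> finType) (A : set (tree_aut X)) (n : nat) :
    set (tree_aut (shift_seq n X)) :=
  fun h => exists s (u : level X n), A s /\ h = aut_section s u.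
Arguments sections {X} A n _.

Definition Usub (X : nat -> finType) (G : groupClosed (tree_aut X)) (n : nat) :
    {pred tree_aut (shift_seq n X)} :=
  generated_by (sections (fun g => g \in G) n).
Arguments Usub {X} G n _.
HB.instance Definition _ (X : nat -> finType) (G : groupClosed (tree_aut X)) n :=
  GroupClosed.on (Usub G n).

Section SelfSimilar.
Variable X : nat -> finType.

Fact section_in_U (G : groupClosed (tree_aut X)) n (g : subT G) (u : level X n) :
  aut_section (val g) u \in Usub G n.
Proof. by apply: mem_generated; exists (val g), u; split=> //; exact: valP. Qed.

Definition sectionU (G : groupClosed (tree_aut X)) n (g : subT G) (u : level X n) :
  subT (Usub G n) := exist (fun h => h \in Usub G n) _ (section_in_U g u).

Definition level_Engel k (w : word k) (f : nat -> nat) (G : groupClosed (tree_aut X)) :=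
  forall n, nEngel w (quoT (stabN G n)) (f n).

Variable R : realType.
Local Open Scope ring_scope.

Definition contracting (G : groupClosed (tree_aut X)) (S : set (tree_aut X))
    (g : nat -> R) (c : R) : Prop :=
  exists n, forall m, (n <= m)%N -> forall h, h \in G -> forall u : level X m,
    (wlen (sections S m) (aut_section h u))%:R <= (wlen S h)%:R / g m + c.

Definition dpt (S : set (tree_aut X)) (c : R) (g : tree_aut X) : option nat :=
  least (fun d => forall u : level X d,
    (wlen (sections S d) (aut_section g u))%:R <= c).
End SelfSimilar.

Section WreathElements.
Variables (X : nat -> finType) (G : groupClosed (tree_aut X)) (k m : nat).
Variables (h : 'I_k -> subT G) (p : level X m).
Local Open Scope group_scope.

Definition topT : {group {perm level X m}} :=
  <<[set lperm (val (h j)) m | j : 'I_k]>>%G.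

Fact lperm_topT j : lperm (val (h j)) m \in topT.
Proof. by apply/mem_gen/imsetP; exists j. Qed.

(* The wreath product over the orbit of [p]; every orbit is of this form. *)
Definition wrU := wreath (subT (Usub G m)) (orb_action topT p).
HB.instance Definition _ := Group.on wrU.

Definition wr_base (g : subT G) : wrU := ([ffun x => sectionU g (val x)], 1).

Definition wr_elt (j : 'I_k) : wrU :=
  ([ffun x => sectionU (h j) (val x)], Subg (lperm_topT j)).
End WreathElements.

Local Open Scope ring_scope.
Local Open Scope classical_set_scope.

Definition prec (R : realType) (f g : nat -> R) : Prop :=
  (fun n => f n / g n) @ \oo --> (0 : R).

(* Main.v *)
(* Put [z := w_(f m) (x, y)], which lies in [St(m)].  Its length is at most
   [max (a(w)^f(m), f(m)) * K] with [K] independent of [m], and this is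
   negligible against [g m]; so for large [m] the sections of [z] at level [m]
   have length less than [c + d] for any given [d > 0], hence at most [c]
   because lengths are integers.  The same holds for the [y_j], and the
   hypothesis on wreath products kills [z] over every orbit of level [m] after
   finitely many further iterations.  As [w (1, y) = 1] in [G], it stays killed
   over that orbit, so the maximum of these numbers works for all orbits. *)

Require Import Defs.
From mathcomp Require Import all_boot all_order all_algebra all_fingroup.
From mathcomp Require Import all_classical all_reals all_analysis.

Set Implicit Arguments.
Unset Strict Implicit.
Unset Printing Implicit Defensive.

Import Order.TTheory GRing.Theory Num.Theory.

Lemma leastP (P : nat -> Prop) m : P m ->
  exists d, [/\ least P = Some d, P d & d <= m].
Proof.
move=> Pm; rewrite /least; case: pselect => [e|[]]; last by exists m; exact/asboolP.
by exists (ex_minn e); case: ex_minnP => d /asboolP Pd dm; split=> //; apply/dm/asboolP.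
Qed.

(** * Subgroups generated by a set, and word length *)

Section Length.
Local Open Scope group_scope.
Variables (gT : groupType) (S : set gT).
Implicit Types (g h : gT) (s : seq gT).

Definition word_over s : Prop := forall a, a \in s -> S a \/ S a^-1.

Lemma prodV s : \prod_(a <- rev (map (fun a => a^-1) s)) a = (\prod_(a <- s) a)^-1.
Proof.
elim: s => [|a s IH] /=; first by rewrite !big_nil invg1.
by rewrite rev_cons -cats1 big_cat big_cons big_nil /= IH big_cons invgM mulg1.
Qed.

Lemma word_overV s : word_over s -> word_over (rev (map (fun a => a^-1) s)).
Proof.
move=> sS a; rewrite mem_rev => /mapP[b /sS bS ->].
by rewrite invgK; case: bS; [right | left].
Qed.

(** The values of words over [S] and its inverses form a subgroup containing [S], so the smallest
    such subgroup lies among them. *)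
Lemma generated_word g : g \in generated_by S ->
  exists s, word_over s /\ \prod_(a <- s) a = g.
Proof.
move=> /asboolP gS.
apply: (gS [set h | exists s, word_over s /\ \prod_(a <- s) a = h]%classic); split; last first.
  move=> a Sa; exists [:: a]; rewrite big_cons big_nil mulg1; split=> //.
  by move=> b; rewrite inE => /eqP ->; left.
split; first by apply/mem_set; exists [::]; rewrite big_nil.
move=> x y /set_mem[s [sS <-]] /set_mem[t [tS <-]]; apply/mem_set.
exists (s ++ rev (map (fun a => a^-1) t)); rewrite big_cat /= prodV; split=> //.
by move=> a; rewrite mem_cat => /orP[/sS|/(word_overV tS)].
Qed.

(** The word [s] makes the set of lengths nonempty, so [wlen] is here a true minimum and not its
    default value. *)
Lemma wlen_le s g : word_over s -> \prod_(a <- s) a = g -> (wlen S g <= size s)%N.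
Proof.
move=> sS sg; rewrite /wlen.
have [|d [-> _ //]] := @leastP (fun n => exists s : seq gT,
    [/\ size s = n, forall a, a \in s -> S a \/ S a^-1
      & \prod_(a <- s) a = g]) (size s).
by exists s.
Qed.

Lemma wlen_word g : g \in generated_by S ->
  exists s, [/\ word_over s, \prod_(a <- s) a = g & size s = wlen S g].
Proof.
move=> /generated_word[s [sS sg]]; rewrite /wlen.
have [|d [-> [t [td tS tg]] _]] := @leastP (fun n => exists s : seq gT,
    [/\ size s = n, forall a, a \in s -> S a \/ S a^-1
      & \prod_(a <- s) a = g]) (size s); first by exists s.
by exists t.
Qed.

Lemma wlen1 : wlen S 1 = 0%N.
Proof.
by apply/eqP; rewrite -leqn0 (@wlen_le [::]) ?big_nil.
Qed.

Lemma wlenM g h : g \in generated_by S -> h \in generated_by S ->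
  (wlen S (g * h) <= wlen S g + wlen S h)%N.
Proof.
move=> /wlen_word[s [sS sg <-]] /wlen_word[t [tS th <-]].
rewrite -size_cat; apply: wlen_le; last by rewrite big_cat /= sg th.
by move=> a; rewrite mem_cat => /orP[/sS|/tS].
Qed.

Lemma wlenV g : g \in generated_by S -> (wlen S g^-1 <= wlen S g)%N.
Proof.
move=> /wlen_word[s [sS sg <-]].
have -> : size s = size (rev (map (fun a => a^-1) s)) by rewrite size_rev size_map.
by apply: wlen_le; [exact: word_overV | rewrite prodV sg].
Qed.
End Length.

(** * Word maps: fixed point 1, transport, growth of length under iteration *)

Section WordMapTheory.
Local Open Scope group_scope.
Variables (k : nat) (w : word k).

Lemma word_iterS (gT : groupType) n (x : gT) y :
  word_iter w n.+1 x y = word_map w (word_iter w n x y) y.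
Proof. by []. Qed.

Lemma word_iterD (gT : groupType) m n (x : gT) y :
  word_iter w (m + n) x y = word_iter w m (word_iter w n x y) y.
Proof. exact: iterD. Qed.

(** The first hypothesis makes 1 a fixed point of the iteration. *)
Lemma word_iter_stable (gT : groupType) m n (x : gT) y : word_map w 1 y = 1 ->
  word_iter w m x y = 1 -> (m <= n)%N -> word_iter w n x y = 1.
Proof.
move=> w1 xm /subnK <-; rewrite word_iterD xm.
by elim: (n - m)%N => // i IH; rewrite word_iterS IH.
Qed.

Section Relation.
Variables (gT hT : groupType) (rel : gT -> hT -> Prop).
Hypothesis rel1 : rel 1 1.
Hypothesis relM : forall a b c d, rel a b -> rel c d -> rel (a * c) (b * d).
Hypothesis relV : forall a b, rel a b -> rel a^-1 b^-1.
Variables (y : 'I_k -> gT) (y' : 'I_k -> hT).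
Hypothesis rely : forall j, rel (y j) (y' j).

(** A multiplicative relation replaces a homomorphism, so that the same transport serves for [val],
    for [coset_proj] and for the partially defined map to a wreath product over an orbit. *)
Lemma word_map_rel x x' : rel x x' -> rel (word_map w x y) (word_map w x' y').
Proof.
move=> relx; rewrite /word_map; elim: w => [|[l b] v IH]; first by rewrite !big_nil.
rewrite !big_cons; apply: relM => //; rewrite /letter_val /=.
by case: l => [j|]; case: b => //; apply: relV.
Qed.

Lemma word_iter_rel n x x' : rel x x' -> rel (word_iter w n x y) (word_iter w n x' y').
Proof. by move=> relx; elim: n => // n IH; rewrite !word_iterS; apply: word_map_rel. Qed.
End Relation.

Section WordLength.
Variables (gT : groupType) (S : set gT) (y : 'I_k -> gT).
Hypothesis Sy : forall j, y j \in generated_by S.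

(** The constant term of an affine bound in [wlen S x] whose slope is [occ_x w]. *)
Definition coef_len : nat :=
  \sum_(a <- w) (if a.1 is Some j then wlen S (y j) else 0%N).

Lemma word_map_gen x : x \in generated_by S -> word_map w x y \in generated_by S.
Proof.
move=> Sx; apply: (big_ind (fun z => z \in generated_by S)).
- exact: gpred1.
- by move=> a b; apply: gpredM.
- by move=> [l b] _; case: l b => [j|] []; rewrite /letter_val /= ?gpredV.
Qed.

Lemma wlen_word_map x : x \in generated_by S ->
  (wlen S (word_map w x y) <= occ_x w * wlen S x + coef_len)%N.
Proof.
move=> Sx; rewrite /word_map /coef_len /occ_x.
(* Subadditivity of [wlen] requires both factors in the subgroup, so membership is carried through
   the induction. *)
suff [] : \prod_(a <- w) letter_val x y a \in generated_by S /\
  (wlen S (\prod_(a <- w) letter_val x y a) <= count (fun a : letter k => a.1 == None) w * wlen S x +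
    \sum_(a <- w) (if a.1 is Some j then wlen S (y j) else 0))%N by [].
elim: w => [|[l b] v [IH1 IH2]]; first by rewrite !big_nil gpred1 wlen1.
rewrite !big_cons.
have Sa : letter_val x y (l, b) \in generated_by S.
  by case: l b => [j|] []; rewrite /letter_val /= ?gpredV.
have la : (wlen S (letter_val x y (l, b)) <= (l == None) * wlen S x +
    (if l is Some j then wlen S (y j) else 0))%N.
  by case: l b {Sa} => [j|] []; rewrite /letter_val /= ?mul1n ?addn0 ?mul0n ?add0n ?wlenV.
split; first exact: gpredM.
apply: leq_trans (wlenM Sa IH1) _.
by rewrite mulnDl addnACA leq_add.
Qed.

Lemma word_iter_gen n x : x \in generated_by S -> word_iter w n x y \in generated_by S.
Proof. by move=> Sx; elim: n => // n IH; apply: word_map_gen. Qed.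

(** Each step multiplies the old bound by [occ_x w] and adds [coef_len], so the constant terms build
    up a geometric sum. *)
Lemma wlen_word_iter n x : x \in generated_by S ->
  (wlen S (word_iter w n x y) <=
    occ_x w ^ n * wlen S x + (\sum_(i < n) occ_x w ^ i) * coef_len)%N.
Proof.
move=> Sx; elim: n => [|n IH]; first by rewrite big_ord0 mul1n addn0.
rewrite word_iterS; apply: leq_trans (wlen_word_map (word_iter_gen n Sx)) _.
rewrite big_ord_recl expn0 mulnDl mul1n addnCA addnC leq_add2l.
apply: leq_trans (leq_mul (leqnn _) IH) _.
rewrite mulnDr !mulnA -expnS leq_add2l leq_mul2r big_distrr /=.
by rewrite (eq_bigr (fun i : 'I_n => occ_x w ^ bump 0 i)%N) ?leqnn ?orbT // => i _; rewrite -expnS.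
Qed.

(** If [a <= 1], there are [n] terms, each at most 1; if [a >= 2], doubling at each step keeps the
    sum below [a ^ n]. This is the source of the maximum in the growth hypothesis. *)
Lemma sum_expn_le a n : (\sum_(i < n) a ^ i <= maxn (a ^ n) n)%N.
Proof.
rewrite leq_max; case: (leqP a 1) => a1; apply/orP; [right|left].
  rewrite -[leqRHS]muln1 -[n in leqRHS]card_ord -sum_nat_const.
  apply: leq_sum => -[i _] _ /=; case: a a1 => [|[|//]] _; last by rewrite exp1n.
  by case: i => // i; rewrite exp0n.
elim: n => [|n IH]; first by rewrite big_ord0.
rewrite big_ord_recr /= expnS; apply: (@leq_trans (2 * a ^ n)).
  by rewrite mul2n -addnn leq_add2r.
by rewrite leq_mul2r a1 orbT.
Qed.

Lemma wlen_word_iter_max n x : x \in generated_by S ->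
  (wlen S (word_iter w n x y) <= maxn (occ_x w ^ n) n * (wlen S x + coef_len))%N.
Proof.
move=> Sx; apply: leq_trans (wlen_word_iter n Sx) _.
by rewrite mulnDr leq_add // leq_mul ?leq_maxl ?sum_expn_le.
Qed.
End WordLength.
End WordMapTheory.

(** * Sections and level actions of tree automorphisms *)

Section TreeTheory.
Local Open Scope group_scope.
Variable X : nat -> finType.
Implicit Types g h : tree_aut X.

Lemma aut_sectionM g h n (u : level X n) :
  aut_section (g * h) u = aut_section g u * aut_section h (lact g u).
Proof.
apply: aut_ext => v; apply: (can_inj (vcatK (lact (g * h) u))).
by rewrite -sectionE lactM /= -!sectionE.
Qed.

Lemma aut_section1 n (u : level X n) : aut_section (1 : tree_aut X) u = 1.
Proof.
apply: aut_ext => v; apply: (can_inj (vcatK (lact (1 : tree_aut X) u))).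
by rewrite -sectionE lact1.
Qed.

Lemma lpermE g n (u : level X n) : lperm g n u = lact g u.
Proof. by rewrite permE. Qed.

Lemma lpermM g h n : lperm (g * h) n = lperm g n * lperm h n.
Proof. by apply/permP => u; rewrite permM !lpermE lactM. Qed.

Lemma lperm1 n : lperm (1 : tree_aut X) n = 1.
Proof. by apply/permP => u; rewrite perm1 lpermE lact1. Qed.

Lemma lpermV g n : lperm g^-1 n = (lperm g n)^-1.
Proof. by apply: (mulgI (lperm g n)); rewrite -lpermM !mulgV lperm1. Qed.

Lemma vcat_surj n (v : vertex X) : (n <= tag v)%N -> exists u q, v = @vcat X n u q.
Proof.
elim: n X v => [|n IH] Y v; first by exists tt, v.
case: v => [[|m] v] //; rewrite ltnS => nm; case: v => a v.
have [u [q E]] := IH (fun i => Y i.+1) (Tagged (level (fun i => Y i.+1)) v) nm.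
by exists (a, u), q; rewrite /= -E.
Qed.

Hypothesis X_inhab : forall n, (0 < #|X n|)%N.

(** Nonempty alphabets let every vertex be extended by a letter, and the parent of a fixed vertex is
    fixed. *)
Lemma lact_fix_lower g m n : (n <= m)%N ->
  (forall u : level X m, lact g u = u) -> forall u : level X n, lact g u = u.
Proof.
move=> /subnK <-; elim: (m - n)%N => // d IH gm; apply: IH => u.
have /card_gt0P[a _] := X_inhab (d + n).
apply: Tagged_level_inj; rewrite lactE.
set v := Tagged (level X) (lrcons u a).
have uv : child (Tagged (level X) u) v by exists a.
apply: child_uniq uv.
have <- : g v = v by rewrite /v -lactE gm.
by apply/aut_child; exists a.
Qed.

Lemma aut_eq1 g m : (forall u : level X m, lact g u = u) ->
  (forall u : level X m, aut_section g u = 1) -> g = 1.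
Proof.
move=> gfix gsec; apply: aut_ext => v; case: (leqP m (tag v)) => [|/ltnW vm].
  by move=> /vcat_surj[u [q ->]]; rewrite sectionE gfix gsec.
by case: v vm => n u /= nm; rewrite -lactE (lact_fix_lower nm gfix).
Qed.
End TreeTheory.

(** * Level stabilisers and the Engel condition on the quotients *)

Section StabTheory.
Local Open Scope group_scope.
Variables (X : nat -> finType) (G : groupClosed (tree_aut X)).

Lemma stab_eq1 (g : subT G) : (forall n, g \in stab G n) -> g = 1.
Proof.
move=> gS; apply: val_inj; apply: aut_ext => -[n u].
by have /forallP/(_ u)/eqP E := gS n; rewrite -lactE E.
Qed.

Variables (k : nat) (w : word k) (f : nat -> nat).
Hypothesis GE : level_Engel w f G.

Lemma coset_proj_word_iter n i (x : subT G) y :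
  coset_proj (stabN G n) (word_iter w i x y) =
  word_iter w i (coset_proj (stabN G n) x) (fun j => coset_proj (stabN G n) (y j)).
Proof.
apply: (@word_iter_rel _ w _ _ (fun a A => coset_proj (stabN G n) a = A)) => //.
- by move=> a A b B <- <-; apply: coset_projM.
- by move=> a A <-; apply: coset_projV.
Qed.

Lemma coset_proj_eq1 n (x : subT G) : coset_proj (stabN G n) x = 1 -> x \in stab G n.
Proof. by move=> /esym/coset_projP; rewrite invg1 mul1g. Qed.

Lemma word_iter_stab n (x : subT G) y : word_iter w (f n) x y \in stab G n.
Proof. by apply: coset_proj_eq1; rewrite coset_proj_word_iter GE. Qed.

(* In [G / St(n)]: [1 = w_(f n + 1) (1, y) = w (w_(f n) (1, y), y) = w (1, y)]. *)
Lemma word_map_1 (y : 'I_k -> subT G) : word_map w 1 y = 1.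
Proof.
apply: stab_eq1 => n; apply: coset_proj_eq1.
rewrite -[word_map w 1 y]/(word_iter w 1 1 y) coset_proj_word_iter.
set y' := fun j => _; rewrite -[coset_proj _ 1]/(1 : quoT (stabN G n)).
rewrite -{1}(GE 1 y') -word_iterD addnC word_iterD; exact: GE.
Qed.
End StabTheory.

(** * Comparison of [G] with the wreath product over one orbit *)

Section WreathRelation.
Local Open Scope group_scope.
Variables (X : nat -> finType) (G : groupClosed (tree_aut X)) (k m : nat).
Variables (h : 'I_k -> subT G) (p : level X m).

(** The graph of the wreath recursion restricted to the orbit of [p]. It is a relation because only
    elements whose action on the level lies in [topT] have an image. *)
Definition wr_rel (z : subT G) (W : wrU h p) : Prop :=
  (forall x, W.1 x = sectionU z (val x)) /\ val W.2 = lperm (val z) m.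

Lemma wr_rel1 : wr_rel 1 1.
Proof.
split=> [x|]; last by rewrite lperm1.
by rewrite ffunE; apply: val_inj; rewrite /= aut_section1.
Qed.

Lemma wr_relM a A b B : wr_rel a A -> wr_rel b B -> wr_rel (a * b) (A * B).
Proof.
move=> [a1 a2] [b1 b2]; split=> [x|]; last by rewrite lpermM -a2 -b2.
rewrite ffunE a1 b1; apply: val_inj.
by rewrite /= aut_sectionM a2 lpermE.
Qed.

Lemma wr_relV a A : wr_rel a A -> wr_rel a^-1 A^-1.
Proof.
move=> [a1 a2]; split=> [x|]; last by rewrite lpermV -a2.
(* [x'] is the preimage of [x] under [a], so the section of the inverse at [x] is the inverse of the
   section of [a] at [x']. *)
rewrite ffunE; set x' := orb_action _ _ _ _.
have -> : val x = lact (val a) (val x').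
  by rewrite /x' /= a2 -lpermE permKV.
rewrite a1; apply: val_inj => /=.
by apply/esym/(mulgI (aut_section (val a) (val x'))); rewrite -aut_sectionM !mulgV aut_section1.
Qed.

Lemma wr_rel_elt j : wr_rel (h j) (wr_elt h p j).
Proof. by split=> [x|] /=; rewrite ?ffunE. Qed.

Lemma wr_rel_base a : a \in stab G m -> wr_rel a (wr_base h p a).
Proof.
move=> /forallP aS; split=> [x|] /=; first by rewrite ffunE.
by apply/permP => u; rewrite perm1 lpermE (eqP (aS u)).
Qed.

Lemma wr_rel_1l W : wr_rel 1 W -> W = 1.
Proof.
case: W => W t [/= W1 t1]; congr pair; last by apply: val_inj; rewrite /= t1 lperm1.
by apply/ffunP => x; rewrite W1 ffunE; apply: val_inj; rewrite /= aut_section1.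
Qed.

(** The base point lies in its own orbit, so the coordinate at [p] can be read off; letting [p] vary
    reaches the whole level. *)
Lemma wr_rel_1r z : wr_rel z 1 -> lact (val z) p = p /\ aut_section (val z) p = 1.
Proof.
move=> [z1 z2]; split; first by rewrite -lpermE -z2 perm1.
have := z1 (exist (fun x => x \in orbit 'P (topT m h) p) p (orbit_refl _ _ _)).
by rewrite ffunE => /(congr1 val) /= <-.
Qed.
End WreathRelation.

Local Open Scope ring_scope.

(** * From contraction to bounded depth *)

Lemma nat_le_gap (R : realType) (c : R) : 0 < c ->
  exists2 d : R, 0 < d & forall n : nat, n%:R < d + c -> n%:R <= c.
Proof.
move=> c0; have /andP[tc ct] := truncn_itv (ltW c0).
(* The distance from [c] up to the next integer above it. *)
exists ((Num.truncn c).+1%:R - c); first by rewrite subr_gt0.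
move=> n; rewrite subrK ltr_nat ltnS => nc.
by apply: le_trans tc; rewrite ler_nat.
Qed.

Lemma contracting_small (R : realType) (X : nat -> finType) (G : groupClosed (tree_aut X))
    (S : set (tree_aut X)) (a g : nat -> nat) (c : R) (K : nat) :
  (forall n, (0 < g n)%N) -> 0 < c ->
  prec (fun n => (a n)%:R : R) (fun n => (g n)%:R) ->
  contracting G S (fun n => (g n)%:R) c ->
  exists N, forall m, (N <= m)%N -> forall h, h \in G ->
    (wlen S h <= a m * K)%N -> at_most (dpt S c h) m.
Proof.
move=> g0 c0 ag [N1 contr].
have [d d0 dc] := nat_le_gap c0.
(* Aiming at [d / K.+1] absorbs the factor [K] in the length bound, and the successor keeps the
   denominator positive when [K = 0]. *)
have e0 : 0 < d / K.+1%:R by rewrite divr_gt0 // ltr0n.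
have /cvgrPdist_lt/(_ _ e0)[N2 _ HN2] := ag.
exists (maxn N1 N2) => m; rewrite geq_max => /andP[m1 m2] h Gh hK.
(* The depth is a least level, so it suffices that level [m] itself qualifies. *)
suff le_c : forall u : level X m, (wlen (sections S m) (aut_section h u))%:R <= c.
  have [n []] := @leastP (fun d => forall u : level X d,
    (wlen (sections S d) (aut_section h u))%:R <= c) m le_c.
  by rewrite /dpt => ->.
move=> u; apply: dc; apply: le_lt_trans (contr m m1 h Gh u) _.
rewrite ltrD2r; have := HN2 m m2; rewrite /= sub0r normrN ger0_norm ?divr_ge0 //.
have gm : 0 < (g m)%:R :> R by rewrite ltr0n.
rewrite ltr_pdivlMr ?ltr0n // => lt; apply: le_lt_trans lt.
rewrite mulrAC ler_pM2r ?invr_gt0 // -natrM ler_nat.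
by apply: leq_trans hK _; rewrite leq_mul2l leqnSn orbT.
Qed.
Theorem theorem2p5 (R : realType) (k : nat) (w : word k) (w_red : reduced w)
    (f : nat -> nat) (f_gt0 : forall n, (0 < f n)%N)
    (X : nat -> finType) (X_ge2 : forall n, (2 <= #|X n|)%N)
    (G : groupClosed (tree_aut X)) (G_Engel : level_Engel w f G)
    (S : set (tree_aut X)) (S_fin : finite_set S) (S_gen : G =i generated_by S)
    (g : nat -> nat) (g_gt1 : forall n, (1 < g n)%N)
    (g_incr : forall m n, (m < n)%N -> (g m < g n)%N)
    (g_dom : prec (fun n => (maxn (occ_x w ^ f n) (f n))%:R%R : R)
                  (fun n => (g n)%:R%R))
    (c : R) (c_gt0 : (0 < c)%R)
    (G_contr : contracting G S (fun n => (g n)%:R%R) c)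
    (G_wr : exists n, forall m, (n <= m)%N ->
      forall h : 'I_k -> subT G, (forall j, at_most (dpt S c (val (h j))) m) ->
      forall (p : level X m) (a : subT G),
        a \in stab G m -> at_most (dpt S c (val a)) m ->
      exists i, word_iter w i (wr_base h p a) (wr_elt h p) = 1%g) :
  Engel w (subT G).
Proof.
move=> x y.
have val_iter i z : val (word_iter w i z y) =
    word_iter w i (val z) (fun j => val (y j)).
  apply: (@word_iter_rel _ w _ _ (fun (a : subT G) b => val a = b)) => //.
  - by move=> a A b B <- <-.
  - by move=> a A <-.
have genG (z : subT G) : val z \in generated_by S by rewrite -S_gen (valP z).
(* Fixed before [m], which depends on it. The first two summands serve the iterate of [x], the last
   one serves each [y j]. *)
pose K := (wlen S (val x) + coef_len w S (fun j => val (y j)) +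
  \sum_j wlen S (val (y j)))%N.
have [|N1 small] := contracting_small K _ c_gt0 g_dom G_contr.
  by move=> n; apply: ltnW.
have [N2 wr] := G_wr.
pose m := maxn N1 N2.
have aS : word_iter w (f m) x y \in stab G m by exact: word_iter_stab.
have /choice[i wri] : forall p : level X m, exists i,
    word_iter w i (wr_base y p (word_iter w (f m) x y)) (wr_elt y p) = 1%g.
  move=> p.
  apply: wr => //; first exact: leq_maxr.
  - move=> j; apply: small; rewrite ?leq_maxl ?(valP (y j)) //.
    apply: (@leq_trans (1 * wlen S (val (y j)))); first by rewrite mul1n.
    (* Positivity of [f m] makes the maximum at least 1, so [K] alone already bounds the length of
       [y j]. *)
    apply: leq_mul; first by rewrite leq_max (f_gt0 m) orbT.
    by rewrite /K (bigD1 j) //= addnCA leq_addr.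
  - apply: small; rewrite ?leq_maxl ?(valP (word_iter w (f m) x y)) //.
    rewrite val_iter; apply: leq_trans (wlen_word_iter_max w _ _ _) _ => //.
    by rewrite leq_mul2l leq_addr orbT.
(* The level is finite, so one exponent dominates those of all its vertices. *)
pose I := (\max_p i p)%N.
exists (I + f m)%N; rewrite word_iterD; apply: val_inj.
have fixp (p : level X m) : lact (val (word_iter w I (word_iter w (f m) x y) y)) p = p /\
    aut_section (val (word_iter w I (word_iter w (f m) x y) y)) p = 1%g.
  (* The identity [w (1, y) = 1] passes from [G] to the wreath product, so the iteration there stays
     at 1 from [i p] up to [I]. *)
  have w1 : word_map w 1%g (wr_elt y p) = 1%g.
    apply: wr_rel_1l; rewrite -(word_map_1 G_Engel y).
    apply: (word_map_rel w (@wr_rel1 _ _ _ _ y p)); last exact: wr_rel1.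
    - exact: wr_relM.
    - exact: wr_relV.
    - exact: wr_rel_elt.
  apply: (@wr_rel_1r _ _ _ _ y).
  rewrite -(word_iter_stable w1 (wri p) (@leq_bigmax _ i p)).
  apply: (word_iter_rel w (@wr_rel1 _ _ _ _ y p)); last exact: wr_rel_base.
  - exact: wr_relM.
  - exact: wr_relV.
  - exact: wr_rel_elt.
by apply: (@aut_eq1 X _ _ m) => [n|p|p]; [exact: ltnW | case: (fixp p)..].
Qed.
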